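(* Let $(V,\varrho,\beta)$ be a representation of a Hom-Malcev algebra $(A,[-,-],\alpha)$ with $\beta$ invertible, and let $V^*$ be the dual vector space of $V$. Define $\varrho^\star:A\to \mathrm{End}(V^* )$ by $$\varrho^\star(x)(\xi)=\varrho^*(\alpha(x))\big((\beta^{-2})^*(\xi)\big),\qquad x\in A,\ \xi\in V^*.$$ Then $\varrho^\star$ is a representation of $(A,[-,-],\alpha)$ on $V^*$ with respect to $(\beta^{-1})^*$.
   Context: All vector spaces are over a field $\mathbb K$ of characteristic $0$. A Hom-Malcev algebra $(A,[-,-],\alpha)$ is a vector space $A$ with an anti-symmetric bilinear bracket $[-,-]$ and a linear map $\alpha:A\to A$ such that for all $x,y,z\in A$: $J_\alpha(\alpha(x),\alpha(y),[x,z])=[J_\alpha(x,y,z),\alpha^2(x)]$, where $J_\alpha(x,y,z)=[[x,y],\alpha(z)]+[[y,z],\alpha(x)]+[[z,x],\alpha(y)]$. A representation of $(A,[-,-],\alpha)$ on a vector space $V$ with respect to $\beta\in \mathrm{End}(V)$, denoted $(V,\varrho,\beta)$, is a linear map $\varrho:A\to \mathrm{End}(V)$ such that for all $x,y,z\in A$: $\varrho(\alpha(x))\beta=\beta\varrho(x)$ and $$\varrho([[x,y],\alpha(z)])\beta^2=\varrho(\alpha^2(x))\varrho(\alpha(y))\varrho(z)-\varrho(\alpha^2(z))\varrho(\alpha(x))\varrho(y)+\varrho(\alpha^2(y))\varrho([z,x])\beta-\varrho(\alpha([y,z]))\varrho(\alpha(x))\beta.$$ $\varrho^*:A\to \mathrm{End}(V^*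 )$ is the linear map defined by $\langle\varrho^*(x)(\xi),a\rangle=-\langle\xi,\varrho(x)(a)\rangle$ for $x\in A$, $a\in V$, $\xi\in V^*$, where $\langle\cdot,\cdot\rangle$ is the canonical pairing. For a linear map $f:V\to V$, $f^*:V^*\to V^*$ denotes its transpose, $\langle f^*(\xi),a\rangle=\langle\xi,f(a)\rangle$. *)

(* Defs.v *)
From HB Require Import structures.
From mathcomp Require Import all_boot all_algebra.
From mathcomp Require Import boolp.

Set Implicit Arguments.
Unset Strict Implicit.
Unset Printing Implicit Defensive.

Import GRing.Theory.
Local Open Scope ring_scope.

(* The K-vector space of linear maps U -> V, for U and V of arbitrary
   (possibly infinite) dimension. *)
Section LinearMaps.
Variables (K : fieldType) (U V : lmodType K).
Implicit Types f g h : {linear U -> V}.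

Lemma lin_ext f g : f =1 g -> f = g.
Proof.
case: f => f [[fD] [fZ]]; case: g => g [[gD] [gZ]] /= /funext fg.
move: fD fZ gD gZ; rewrite {}fg => fD fZ gD gZ.
by rewrite (Prop_irrelevance fD gD) (Prop_irrelevance fZ gZ).
Qed.

HB.instance Definition _ := gen_eqMixin {linear U -> V}.
HB.instance Definition _ := gen_choiceMixin {linear U -> V}.

Definition lin0 : {linear U -> V} := \0.
Definition lin_add f g : {linear U -> V} := f \+ g.
Definition lin_opp f : {linear U -> V} := \- f.
Definition lin_scale (a : K) f : {linear U -> V} := a \*: f.

Fact lin_addA : associative lin_add.
Proof. by move=> f g h; apply: lin_ext => u /=; rewrite addrA. Qed.
Fact lin_addC : commutative lin_add.
Proof. by move=> f g; apply: lin_ext => u /=; rewrite addrC. Qed.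
Fact lin_add0 : left_id lin0 lin_add.
Proof. by move=> f; apply: lin_ext => u /=; rewrite add0r. Qed.
Fact lin_addN : left_inverse lin0 lin_opp lin_add.
Proof. by move=> f; apply: lin_ext => u /=; rewrite addNr. Qed.

HB.instance Definition _ := GRing.isZmodule.Build {linear U -> V}
  lin_addA lin_addC lin_add0 lin_addN.

Fact lin_scaleA a b f : lin_scale a (lin_scale b f) = lin_scale (a * b) f.
Proof. by apply: lin_ext => u /=; rewrite scalerA. Qed.
Fact lin_scale1 : left_id 1 lin_scale.
Proof. by move=> f; apply: lin_ext => u /=; rewrite scale1r. Qed.
Fact lin_scaleDr : right_distributive lin_scale +%R.
Proof. by move=> a f g; apply: lin_ext => u /=; rewrite scalerDr. Qed.
Fact lin_scaleDl f : {morph lin_scale^~ f : a b / a + b}.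
Proof. by move=> a b; apply: lin_ext => u /=; rewrite scalerDl. Qed.

HB.instance Definition _ := GRing.Zmodule_isLmodule.Build K {linear U -> V}
  lin_scaleA lin_scale1 lin_scaleDr lin_scaleDl.

Lemma lin_addE f g u : (f + g) u = f u + g u. Proof. by []. Qed.
Lemma lin_oppE f u : (- f) u = - f u. Proof. by []. Qed.
Lemma lin_scaleE (a : K) f u : (a *: f) u = a *: f u. Proof. by []. Qed.

End LinearMaps.

(* The canonical pairing <xi, a> of xi : dual V with a : V is xi a. *)
Definition dual (K : fieldType) (V : lmodType K) := {linear V -> K^o}.
HB.instance Definition _ (K : fieldType) (V : lmodType K) :=
  GRing.Lmodule.on (dual V).

Section HomMalcev.
Variables (K : fieldType) (A : lmodType K).
Variables (br : {bilinear A -> A -> A}) (alpha : {linear A -> A}).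

Definition hom_jacobian (x y z : A) : A :=
  br (br x y) (alpha z) + br (br y z) (alpha x) + br (br z x) (alpha y).

Definition is_hom_malcev : Prop :=
  (forall x y, br x y = - br y x) /\
  (forall x y z, hom_jacobian (alpha x) (alpha y) (br x z) =
                 br (hom_jacobian x y z) (alpha (alpha x))).

Definition is_hom_malcev_rep (V : lmodType K) (rho : A -> {linear V -> V})
    (beta : {linear V -> V}) : Prop :=
  [/\ linear rho,
      forall x v, rho (alpha x) (beta v) = beta (rho x v)
    & forall x y z v,
        rho (br (br x y) (alpha z)) (beta (beta v)) =
          rho (alpha (alpha x)) (rho (alpha y) (rho z v))
          - rho (alpha (alpha z)) (rho (alpha x) (rho y v))
          + rho (alpha (alpha y)) (rho (br z x) (beta v))
          - rho (alpha (br y z)) (rho (alpha x) (beta v))].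

End HomMalcev.

Section Dual.
Variables (K : fieldType) (V : lmodType K).

Definition transpose_fun (f : {linear V -> V}) (xi : dual V) : dual V := xi \o f.

Fact transpose_linear f : linear (transpose_fun f).
Proof. by move=> a xi eta; apply: lin_ext. Qed.
HB.instance Definition _ f := GRing.isLinear.Build K (dual V) (dual V) *:%R
  (transpose_fun f) (transpose_linear f).

Definition transpose (f : {linear V -> V}) : {linear dual V -> dual V} :=
  transpose_fun f.

Lemma transposeE f xi a : transpose f xi a = xi (f a).
Proof. by []. Qed.

Variable A : lmodType K.

Definition dual_map (rho : A -> {linear V -> V}) (x : A) :
    {linear dual V -> dual V} := - transpose (rho x).

Lemma dual_mapE rho x xi a : dual_map rho x xi a = - xi (rho x a).
Proof. by []. Qed.

Definition dual_rep (alpha : {linear A -> A}) (rho : A -> {linear V -> V})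
    (beta_inv : {linear V -> V}) (x : A) : {linear dual V -> dual V} :=
  dual_map rho (alpha x) \o transpose (beta_inv \o beta_inv).

End Dual.

(* Main.v *)
Require Import Defs.
From mathcomp Require Import all_boot all_algebra.
Set Implicit Arguments.
Unset Strict Implicit.
Unset Printing Implicit Defensive.
Import GRing.Theory.
Local Open Scope ring_scope.

(** Since beta is invertible, the intertwining relation reads
    rho (alpha x) = beta (rho x) beta^-1, so alpha can be eliminated from the
    dual map: rho^star x is minus the transpose of beta^-1 (rho x) beta^-1
    ([dual_repE]).  The intertwining relation for rho^star is then immediate.

    Transposition reverses products of operators, and each factor of rho^star
    carries a sign.  So the second axiom for rho^star, pulled back to V and
    conjugated by powers of beta, becomes the second axiom for rho with every
    product written in the reverse order and with the products of two factors
    changing sign, up to factors alpha and beta.  The point is that rho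
    satisfies this reversed identity too ([rep_bracket_rev]): the left-hand
    side rho (br (br x y) (alpha z)) beta^2 is antisymmetric in x and y, so it
    is also minus the right-hand side of the axiom for (y, x, z), and this
    expression consists exactly of the reversed products. *)

Section Representation.
Variables (K : fieldType) (A : lmodType K).
Variables (br : {bilinear A -> A -> A}) (alpha : {linear A -> A}).
Variables (V : lmodType K) (rho : A -> {linear V -> V}).
Variables (beta : {linear V -> V}).
Hypothesis rho_rep : is_hom_malcev_rep br alpha rho beta.

Lemma rep_opp x v : rho (- x) v = - rho x v.
Proof.
have [rho_lin _ _] := rho_rep.
have rho0 : rho 0 = 0.
  by have := rho_lin (-1) 0 0; rewrite scaler0 addr0 scaleN1r addNr.
by have := rho_lin (-1) x 0; rewrite !scaleN1r !addr0 rho0 addr0 => ->.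
Qed.

(** This is minus the axiom for (y, x, z).  The brackets [z,y] and [x,z] that
    occur there are - [y,z] and - [z,x], so the two terms with a bracket keep
    the signs that they have in the axiom. *)
Lemma rep_bracket_rev (br_anti : forall x y, br x y = - br y x) x y z v :
  rho (br (br x y) (alpha z)) (beta (beta v)) =
    rho (alpha (alpha z)) (rho (alpha y) (rho x v))
    - rho (alpha (alpha y)) (rho (alpha x) (rho z v))
    + rho (alpha (alpha x)) (rho (br y z) (beta v))
    - rho (alpha (br z x)) (rho (alpha y) (beta v)).
Proof.
have [_ _ rep_br] := rho_rep.
rewrite (br_anti x y) linearNl rep_opp rep_br.
rewrite (br_anti z y) (br_anti x z) !linearN !rep_opp !linearN /=.
by rewrite !opprD !opprK [- _ + _]addrC.
Qed.

Variable beta_inv : {linear V -> V}.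
Hypotheses (betaK : cancel beta beta_inv) (beta_invK : cancel beta_inv beta).

Lemma rep_alphaE x v : rho (alpha x) v = beta (rho x (beta_inv v)).
Proof. by have [_ rep_al _] := rho_rep; rewrite -rep_al beta_invK. Qed.

Lemma dual_repE x (xi : dual V) v :
  dual_rep alpha rho beta_inv x xi v = - xi (beta_inv (rho x (beta_inv v))).
Proof. by rewrite -[rho x _]betaK -rep_alphaE. Qed.

End Representation.

Theorem lemma2p1 (K : fieldType) (charK0 : has_pchar0 K)
    (A : lmodType K) (br : {bilinear A -> A -> A}) (alpha : {linear A -> A})
    (malcevA : is_hom_malcev br alpha)
    (V : lmodType K) (rho : A -> {linear V -> V}) (beta : {linear V -> V})
    (rho_rep : is_hom_malcev_rep br alpha rho beta)
    (beta_inv : {linear V -> V})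
    (betaK : cancel beta beta_inv) (beta_invK : cancel beta_inv beta) :
  is_hom_malcev_rep br alpha
    (dual_rep alpha rho beta_inv)
    (transpose beta_inv).
Proof.
have [br_anti _] := malcevA; have [rho_lin _ _] := rho_rep.
have rhoE := rep_alphaE rho_rep beta_invK.
have dualE := dual_repE rho_rep betaK beta_invK.
split=> [a x y | x xi | x y z xi].
- apply: lin_ext => xi; apply: lin_ext => v.
  rewrite !(lin_addE, lin_scaleE) !dualE rho_lin.
  by rewrite lin_addE lin_scaleE !linearP.
- apply: lin_ext => v.
  by rewrite dualE !transposeE dualE rhoE betaK.
apply: lin_ext => v.
(* With v = beta^3 w, the operator on the left acts on beta^2 w, as in the
   reversed identity. *)
rewrite -[v]beta_invK -[beta_inv v]beta_invK -[beta_inv (beta_inv v)]beta_invK.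
set w := beta_inv (beta_inv (beta_inv v)).
rewrite !(dualE, lin_addE, lin_oppE) !transposeE !betaK.
rewrite (rep_bracket_rev rho_rep br_anti).
rewrite !(rhoE, betaK) !(linearD beta_inv, linearN beta_inv) !betaK.
rewrite !(linearD (xi : {linear V -> K^o}), linearN (xi : {linear V -> K^o})).
by rewrite !opprD !opprK addrAC.
Qed.
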